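(* Let $S:\widetilde V'\to\widetilde V$ be symmetric and positive-definite, let $\delta>1$ be a constant, and assume that $$\lambda_{\max}(SA)\le 1,\qquad \|\tilde u_h-u_h\|_{S^{-1}}\le\sqrt{\delta}\,\|\tilde u_h-u_h\|_a .$$ Let $m\ge 1$ be an integer and let $R_mu_h$ be the output of the $m$-step smoothing iteration with initial guess $u_h$ (defined in the context). Then $$\|u-R_mu_h\|_a\le 2\|u-\tilde u_h\|_a+\varepsilon_m(\delta)\,\|u-u_h\|_a,$$ where $$\varepsilon_m(\delta)=\begin{cases}\left(\dfrac{\delta-1}{\delta}\right)^m, & m\le(\delta-1)/2,\\[2mm] \delta^{1/2}\,\dfrac{m^m(1/2)^{1/2}}{(m+1/2)^{m+1/2}}, & m>(\delta-1)/2.\end{cases}$$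
   Context: $V\subset\widetilde V$ are finite-dimensional real vector spaces (finite element spaces), and $a:\widetilde V\times\widetilde V\to\mathbb R$ is a symmetric, coercive (positive-definite) bilinear form with energy norm $\|v\|_a=\sqrt{a(v,v)}$. $\widetilde V'$ is the dual of $\widetilde V$ and $\langle\cdot,\cdot\rangle$ the duality pairing between $\widetilde V'$ and $\widetilde V$. The operator $A:\widetilde V\to\widetilde V'$ is defined by $\langle Av,w\rangle=a(v,w)$ for $v,w\in\widetilde V$. Given $f\in V'$ and $\tilde f\in\widetilde V'$ with $\tilde f|_V=f$, the element $u_h\in V$ is the solution of $a(u_h,v)=f(v)$ for all $v\in V$, and $\tilde u_h\in\widetilde V$ is the solution of $a(\tilde u_h,v)=\tilde f(v)$ for all $v\in\widetilde V$. The element $u$ is the exact solution being approximated; it may lie outside $\widetilde V$, and $\|\cdot\|_a$ is understood to extend to a seminorm on $\widetilde V+\mathrm{span}\{u\}$ that agrees with the energy norm on $\widetilde V$. A linear operator $S:\widetilde V'\to\widetilde V$ is symmetric and positive-definite if $\langle g_1,Sg_2\rangle=\langle g_2,Sg_1\rangle$ for all $g_1,g_2\in\widetilde V'$ and $\langle g,Sg\rangle>0$ for all $0\ne g\in\widetilde V'$. Then $\|v\|_{S^{-1}}=\langle S^{-1}v,v\rangle^{1/2}$, and $SA$ is self-adjoint and positive-definite with respect to the inner product $(v,w)_{S^{-1}}=\langle S^{-1}v,w\rangle$; $\lambda_{\max}(SA)$ is its largest eigenvalue. $m$-step smoothing iteration: set $u_0=u_h$, $u_k=u_{k-1}+S(\tilde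 f-Au_{k-1})$ for $k=1,\dots,m$, and $R_mu_h=u_m$. *)

(* Defs.v *)
From HB Require Import structures.
From mathcomp Require Import all_boot all_order all_algebra.
From mathcomp Require Import all_classical all_reals exp.

Set Implicit Arguments.
Unset Strict Implicit.
Unset Printing Implicit Defensive.

Import Order.TTheory GRing.Theory Num.Theory.

Local Open Scope classical_set_scope.
Local Open Scope ring_scope.

Notation dual V := 'Hom(V, _^o).

Section TwoLevel.
Context {R : realType} {Vt : vectType R}.

(* [{dot Vt for idfun}] is the library's type of symmetric, positive definite
   bilinear forms on [Vt]. *)
Implicit Types (a : {dot Vt for idfun}) (S : 'Hom(dual Vt, Vt)).

Definition energy_norm a (v : Vt) : R := Num.sqrt (a v v).

Definition energy_op a : 'Hom(Vt, dual Vt) :=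
  linfun (fun v : Vt => linfun (a v : Vt -> R^o)).

(* [linfun] is only meaningful on linear maps. *)
Lemma energy_opE a v w : energy_op a v w = a v w.
Proof.
have lin_in (x : Vt) : linear (a x : Vt -> R^o).
  by move=> c y z; rewrite linearPr.
pose g x : {linear Vt -> R^o} :=
  HB.pack (a x : Vt -> R^o) (GRing.isLinear.Build _ _ _ _ _ (lin_in x)).
have E x y : linfun (a x : Vt -> R^o) y = a x y := lfunE (g x) y.
have lin_out : linear (fun x : Vt => linfun (a x : Vt -> R^o)).
  move=> c x y; apply/lfunP => z.
  by rewrite add_lfunE scale_lfunE !E linearPl.
pose h : {linear Vt -> dual Vt} :=
  HB.pack (fun x : Vt => linfun (a x : Vt -> R^o))
    (GRing.isLinear.Build _ _ _ _ _ lin_out).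
by rewrite /energy_op (lfunE h) E.
Qed.

Definition symmetric_posdef S : Prop :=
  (forall g1 g2 : dual Vt, g1 (S g2) = g2 (S g1)) /\
  (forall g : dual Vt, g != 0 -> 0 < g (S g)).

(* [S^-1] is a priori only a section of [S] on its image; a positive definite
   [S] is bijective, because [dual Vt] and [Vt] have the same dimension, and
   [S^-1] is then its two-sided inverse. *)
Definition inv_norm S (v : Vt) : R := Num.sqrt ((S^-1)%VF v v).

(* The eigenvalues form a finite set, so the supremum is a maximum as soon as
   there is an eigenvalue; it is 0 on the zero space. *)
Definition lambda_max (f : 'End(Vt)) : R := sup [set l | passmx.leigenvalue f l].

Definition smooth_step a S (ft : dual Vt) (w : Vt) : Vt :=
  w + S (ft - energy_op a w).

Definition smoothing a S ft (m : nat) (w : Vt) : Vt :=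
  iter m (smooth_step a S ft) w.

End TwoLevel.

Section Seminorm.
Context {R : realType} {X : lmodType R}.

Definition seminorm_on (D : set X) (p : X -> R) : Prop :=
  [/\ forall x, D x -> 0 <= p x,
      forall c x, D x -> p (c *: x) = `|c| * p x
    & forall x y, D x -> D y -> p (x + y) <= p x + p y].

(* Vt + span {u}, for Vt embedded in X through iota. *)
Definition add_span (Vt : lmodType R) (iota : Vt -> X) (u : X) : set X :=
  [set x | exists v c, x = iota v + c *: u].

End Seminorm.

Definition eps_m {R : realType} (delta : R) (m : nat) : R :=
  if m%:R <= (delta - 1) / 2 then ((delta - 1) / delta) ^+ m
  else delta `^ (1 / 2) *
       (m%:R ^+ m * (1 / 2) `^ (1 / 2) / (m%:R + 1 / 2) `^ (m%:R + 1 / 2)).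

(* Main.v *)
From HB Require Import structures.
Require Import Defs.
From mathcomp Require Import all_boot all_order all_algebra.
From mathcomp Require Import all_classical all_reals exp.
From mathcomp Require Import ring lra.

Import Order.TTheory GRing.Theory Num.Theory.
Local Open Scope ring_scope.

Set Implicit Arguments.
Unset Strict Implicit.

(** Let e be the difference of the two Galerkin solutions, T = SA and
    D = 1 - T.  Since [uth] is a fixed point of the smoother, m smoothing steps
    turn the error e into D^m e ([smoothing_error]).  For the inner product b
    given by S^-1 ([inv_form_dot]) one has a(v, w) = b(Tv, w), so T and D are
    b-self-adjoint, and D is positive semidefinite because the eigenvalues of T
    are at most 1 ([quadratic_form_le_eigenvalues]).  The quantity to be bounded is
      a(D^m e, D^m e) = mu_n - mu_(n+1),  with n = 2m, mu_k = b(D^k e, e).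

    In an eigenbasis this would be an estimate of the mean of the function
    F(l) = l (1 - l)^n on [0, 1] for a measure whose mean of l is at least
    1/delta, and one would bound F by its tangent at some x <= 1/(n+1).  No
    diagonalization is needed: once D is divided by 1 - x, the gap between the
    tangent and F is (1 - t)^2 times a polynomial with nonnegative
    coefficients in t = (1 - l)/(1 - x).  In terms of moments this says that
    the inequality follows from the convexity of k |-> b(t^k e, e) alone, which
    is the positivity of b(t^k w, w) at w = e - t e ([moments_convex],
    [convex_seq_bound], [smoothing_bound]).

    The two cases of [eps_m] are two choices of the point of tangency
    ([smoothing_reduction]): x = 1/delta is allowed when delta >= n + 1, and
    otherwise x = 1/(n+1), where F is maximal.  This gives
    |D^m e|_a <= eps_m |e|_a; the theorem follows from the triangle inequality
    applied twice, together with eps_m <= 1. *)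

(** * Bilinear forms in finite dimension *)

Lemma limg_full_of_lker0 {K : fieldType} {aT rT : vectType K} {f : 'Hom(aT, rT)} :
  lker f == 0%VS -> \dim {:aT} = \dim {:rT} -> limg f = fullv.
Proof.
move=> /eqP inj dims.
by apply/eqP; rewrite eqEdim subvf /= limg_dim_eq ?dims// inj capv0.
Qed.

Section PositiveForms.
Context {R : realType} {Vt : vectType R}.

Lemma dim_dual : \dim {:dual Vt} = \dim {:Vt}.
Proof. by rewrite !dimvf; exact: muln1. Qed.

(** Only semidefiniteness is assumed: it is all that is known a priori of the
    form M b - b(T _, _) in [quadratic_form_le_eigenvalues]. *)
Lemma psd_cauchy_schwarz (q : Vt -> Vt -> R) :
    (forall t v w x, q (t *: v + w) x = t * q v x + q w x) ->
    (forall v w, q v w = q w v) -> (forall v, 0 <= q v v) ->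
  forall v w, q v w ^+ 2 <= q v v * q w w.
Proof.
move=> qlin qC q_ge0 v w.
have expand s t : 0 <= s ^+ 2 * q v v - 2 * s * t * q v w + t ^+ 2 * q w w.
  have lin0 x : q 0 x = 0.
    by have := qlin 1 0 0 x; rewrite scaler0 addr0 mul1r => /eqP; lra.
  have comb x : q (s *: v + (- t) *: w) x = s * q v x - t * q w x.
    by rewrite qlin -[(- t) *: w]addr0 qlin lin0 addr0 mulNr.
  have := q_ge0 (s *: v + (- t) *: w).
  rewrite comb ![q _ (_ + _)]qC !comb [q w v]qC; lra.
have := expand (q w w) (q v w); have := q_ge0 w; have := q_ge0 v.
rewrite [0 <= q w w]le_eqVlt => v_ge0 /orP[/eqP w0 _|w_gt0].
  (* This t makes the affine function q v v - 2 t q v w equal to -1. *)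
  have := expand 1 ((q v v + 1) / (2 * q v w)).
  rewrite -w0 !mulr0 addr0 expr1n mulr1 mul1r.
  have [->|vw0] := eqVneq (q v w) 0; first by rewrite expr2 !mulr0 lexx.
  have -> : 2 * ((q v v + 1) / (2 * q v w)) * q v w = q v v + 1 by field.
  lra.
have -> : q w w ^+ 2 * q v v - 2 * q w w * q v w * q v w + q v w ^+ 2 * q w w
  = q w w * (q v v * q w w - q v w ^+ 2) by ring.
by rewrite pmulr_rge0// subr_ge0.
Qed.

Implicit Types b : {dot Vt for idfun}.

Lemma dotC b v w : b v w = b w v.
Proof. by rewrite hermC /= mul1r. Qed.

Lemma dotPl b t v w x : b (t *: v + w) x = t * b v x + b w x.
Proof. by rewrite linearPl. Qed.

Lemma dotZl b t v w : b (t *: v) w = t * b v w.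
Proof. exact: linearZl_LR. Qed.

Lemma dotBl b v w x : b (v - w) x = b v x - b w x.
Proof. exact: linearBl. Qed.

Lemma dotBr b x v w : b x (v - w) = b x v - b x w.
Proof. exact: linearBr. Qed.

Lemma dot_ge0 b v : 0 <= b v v.
Proof.
have [->|v0] := eqVneq v 0; first by rewrite linear0r.
by rewrite ltW// neq0_dnorm_gt0.
Qed.

Lemma riesz_representation b (phi : dual Vt) :
  exists r, forall v, phi v = b r v.
Proof.
have inj : lker (energy_op b) == 0%VS.
  apply/eqP/vspaceP => v; rewrite memv_ker memv0; apply/eqP/eqP => [/lfunP/(_ v)|->].
    rewrite energy_opE zero_lfunE => /eqP; apply: contraTeq => v0.
    by rewrite gt_eqF// neq0_dnorm_gt0.
  by rewrite linear0.
have full := limg_full_of_lker0 inj (esym dim_dual).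
exists ((energy_op b)^-1%VF phi) => v.
by rewrite -energy_opE limg_lfunVK// full memvf.
Qed.

(** The coordinates of v are b-products with fixed vectors by Riesz, so
    b(Lv, v) is a sum of products of two linear forms, each of which is
    controlled by Cauchy-Schwarz. *)
Lemma quadratic_form_bounded b (L : 'End(Vt)) :
  exists2 C, 0 < C & forall v, b (L v) v <= C * b v v.
Proof.
pose e := vbasis {:Vt}.
have /boolp.choice[r rE] i : exists r, forall v, coord e i v = b r v.
  have [r rP] := riesz_representation b (linfun (coord e i : Vt -> R^o)).
  by exists r => v; rewrite -rP lfunE.
pose K i := (b (r i) (r i) + b (L e`_i) (L e`_i)) / 2.
have CS := @psd_cauchy_schwarz b (dotPl b) (dotC b) (dot_ge0 b).
have K_ge0 i : 0 <= K i by rewrite divr_ge0// addr_ge0// dot_ge0.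
exists (1 + \sum_i K i) => [|v]; first by rewrite ltr_pwDl// sumr_ge0.
have -> : b (L v) v = \sum_i b (r i) v * b (L e`_i) v.
  rewrite {1}(coord_vbasis (memvf v)) linear_sum /= linear_sumlz.
  by apply: eq_bigr => i _; rewrite linearZ linearZl_LR rE.
rewrite mulrDl mul1r ler_wpDl ?dot_ge0// mulr_suml; apply: ler_sum => i _.
have := CS (r i) v; have := CS (L e`_i) v; rewrite /K.
have := sqr_ge0 (b (r i) v - b (L e`_i) v); lra.
Qed.

(** * Quadratic forms and eigenvalues *)

(** Let M >= r be the best constant such that b(Tv, v) <= M b(v, v).  If M > r,
    then M is not an eigenvalue, so G = T - M is invertible.  The form
    q(v, w) = - b(Gv, w) is positive semidefinite, and Cauchy-Schwarz for q
    together with the boundedness of G^-1 yields b(v, v) <= C q(v, v): the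
    constant M can be lowered by 1/C, a contradiction. *)
Lemma quadratic_form_le_eigenvalues b (T : 'End(Vt)) (r : R) :
    (forall v w, b (T v) w = b v (T w)) ->
    (forall l, passmx.leigenvalue T l -> l <= r) ->
  forall v, b (T v) v <= r * b v v.
Proof.
move=> Tsym eig_le.
(* Requiring r <= s bounds the set of admissible constants from below. *)
pose E : set R := [set s | r <= s /\ forall v, b (T v) v <= s * b v v]%classic.
have [C0 _ C0P] := quadratic_form_bounded b T.
have E0 : (E !=set0)%classic.
  exists (Num.max r C0); split; first by rewrite le_max lexx.
  by move=> v; rewrite (le_trans (C0P v))// ler_wpM2r ?dot_ge0// le_max lexx orbT.
have Elb : has_lbound E by exists r => s [].
pose M := inf E.
have rM : r <= M by apply: lb_le_inf => // s [].
have MP v : b (T v) v <= M * b v v.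
  have [->|v0] := eqVneq v 0; first by rewrite linear0 linear0r mulr0.
  have bv := neq0_dnorm_gt0 (s := b) v v0.
  rewrite -ler_pdivrMr//; apply: lb_le_inf => // s [_ sP].
  by rewrite ler_pdivrMr.
move: rM; rewrite le_eqVlt => /orP[/eqP -> //|rM].
have inj : lker (T - M *: \1%VF) == 0%VS.
  by apply: contraLR rM => /eig_le; rewrite -leNgt.
pose G : 'End(Vt) := (T - M *: \1%VF).
have GE v : G v = T v - M *: v by rewrite add_lfunE opp_lfunE scale_lfunE id_lfunE.
pose q v w := M * b v w - b (T v) w.
have qE v w : q v w = - b (G v) w.
  by rewrite GE dotBl dotZl opprB.
have CS v w : q v w ^+ 2 <= q v v * q w w.
  apply: psd_cauchy_schwarz => [t x y z|x y|x].
  - by rewrite /q linearP !dotPl; ring.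
  - by rewrite /q Tsym dotC [b x (T y)]dotC.
  - by rewrite subr_ge0.
have [C C_gt0 CP] := quadratic_form_bounded b (- (G^-1)%VF).
have gap v : b v v <= C * q v v.
  have [->|v0] := eqVneq v 0; first by rewrite /q linear0 linear0r !mulr0 subr0 mulr0.
  have bv := neq0_dnorm_gt0 (s := b) v v0.
  pose W := (- (G^-1)%VF : 'End(Vt)) v.
  have GW : G W = - v by rewrite /W opp_lfunE linearN /= lker0_lfunVK.
  have qW x : q W x = b v x by rewrite qE GW linearNl opprK.
  have qv : 0 <= q v v by rewrite subr_ge0.
  rewrite -(ler_pM2l bv); apply: le_trans (_ : b W v * q v v <= _).
    by have := CS W v; rewrite !qW expr2 [b v W]dotC.
  by rewrite [leRHS]mulrA [b v v * C]mulrC ler_wpM2r// CP.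
have : E (Num.max r (M - C^-1)).
  split; first by rewrite le_max lexx.
  move=> v; apply: le_trans (_ : (M - C^-1) * b v v <= _); last first.
    by rewrite ler_wpM2r ?dot_ge0// le_max lexx orbT.
  rewrite mulrBl lerBrDr -lerBrDl ler_pdivrMl//; exact: gap.
move=> /(ge_inf Elb); rewrite -/M le_max lt_geF//= lerDl oppr_ge0.
by rewrite lt_geF// invr_gt0.
Qed.

(** [lambda_max] is a supremum, so the set of eigenvalues has to be shown to be
    bounded; any inner product provides a bound. *)
Lemma eigenvalue_le_lambda_max b (T : 'End(Vt)) l :
  passmx.leigenvalue T l -> l <= lambda_max T.
Proof.
have [C _ CP] := quadratic_form_bounded b T.
apply: ub_le_sup; exists C => {}l /=; rewrite /passmx.leigenvalue -vpick0.
set v := vpick _ => v0.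
have : v \in lker (T - l *: \1%VF) by exact: memv_pick.
rewrite memv_ker add_lfunE opp_lfunE scale_lfunE id_lfunE subr_eq0 => /eqP Tv.
have := CP v; rewrite Tv dotZl ler_pM2r//; exact: neq0_dnorm_gt0.
Qed.

(** * Moments of a positive operator *)

Lemma iter_sym b (D : 'End(Vt)) : (forall v w, b (D v) w = b v (D w)) ->
  forall k v w, b (iter k D v) w = b v (iter k D w).
Proof. by move=> Dsym; elim=> [//|k IH] v w; rewrite iterSr IH Dsym. Qed.

(** For even k = 2i the value is b(D^i v, D^i v), for odd k = 2i + 1 it is
    b(D (D^i v), D^i v). *)
Lemma iter_psd b (D : 'End(Vt)) :
    (forall v w, b (D v) w = b v (D w)) -> (forall v, 0 <= b (D v) v) ->
  forall k v, 0 <= b (iter k D v) v.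
Proof.
move=> Dsym D_ge0 k v; rewrite -(odd_double_half k) addnC -addnn -addnA.
rewrite iterD iter_sym//; case: odd => /=; last by rewrite addn0 dot_ge0.
by rewrite addn1 iterS.
Qed.

(** The second difference of mu at k is b(D^k w, w) with w = e - D e. *)
Lemma moments_convex b (D : 'End(Vt)) e (mu := fun k => b (iter k D e) e) :
    (forall v w, b (D v) w = b v (D w)) -> (forall v, 0 <= b (D v) v) ->
  forall k, mu k.+1 - mu k.+2 <= mu k - mu k.+1.
Proof.
move=> Dsym D_ge0 k; rewrite -subr_ge0.
have := iter_psd Dsym D_ge0 k (e - D e).
have iterB : iter k D (e - D e) = iter k D e - iter k.+1 D e.
  rewrite iterSr; elim: k => //= k ->; exact: linearB.
have shift j : b (iter j D e) (D e) = mu j.+1 by rewrite -Dsym.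
by rewrite iterB dotBl !dotBr !shift.
Qed.

End PositiveForms.

(** With d_k = mu_k - mu_(k+1), which is nonincreasing, the difference of the
    two sides is x (d_0 + ... + d_(n-1)) + (1 - (n+1) x) d_0 - (1 - x) d_n.  Each
    d_k with k < n may be replaced by d_n, and the coefficients, which are
    nonnegative on those terms, add up to 0. *)
Lemma convex_seq_bound {R : realType} (mu : nat -> R) (x : R) (n : nat) :
    0 <= x -> n.+1%:R * x <= 1 ->
    (forall k, mu k.+1 - mu k.+2 <= mu k - mu k.+1) ->
  mu n - (1 - x) * mu n.+1 <=
    x * mu 0%N + (1 - n.+1%:R * x) * (mu 0%N - mu 1%N).
Proof.
move=> x_ge0 nx_le1 convex.
have d_le k : mu k - mu k.+1 <= mu 0%N - mu 1%N.
  by elim: k => [//|k]; apply: le_trans.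
have sum_le k : k%:R * (mu k - mu k.+1) <= mu 0%N - mu k.
  elim: k => [|k IH]; first by rewrite mul0r subrr.
  have : k.+1%:R * (mu k.+1 - mu k.+2) <= k.+1%:R * (mu k - mu k.+1).
    by rewrite ler_wpM2l.
  rewrite -[in leRHS]natr1; lra.
have := ler_wpM2l x_ge0 (sum_le n).
have cx : 0 <= 1 - n.+1%:R * x by rewrite subr_ge0.
have := ler_wpM2l cx (d_le n).
rewrite -natr1; lra.
Qed.

(** The right-hand side is the moment of the tangent at x to
    l |-> l (1 - l)^n: the value of this function at x is (1 - x)^n x, and its
    slope there is (1 - x)^n (1 - (n+1) x) / (1 - x). *)
Lemma smoothing_bound {R : realType} {Vt : vectType R} (b : {dot Vt for idfun})
    (D : 'End(Vt)) (e : Vt) (x : R) (n : nat) :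
    (forall v w, b (D v) w = b v (D w)) -> (forall v, 0 <= b (D v) v) ->
    0 <= x -> x < 1 -> n.+1%:R * x <= 1 ->
  b (iter n D e) e - b (iter n.+1 D e) e <=
    (1 - x) ^+ n * (x * b e e +
      (1 - n.+1%:R * x) * ((b e e - b (D e) e - x * b e e) / (1 - x))).
Proof.
move=> Dsym D_ge0 x_ge0 x_lt1 nx_le1.
have c_gt0 : 0 < 1 - x by rewrite subr_gt0.
pose t : 'End(Vt) := (1 - x)^-1 *: D.
have tE v : t v = (1 - x)^-1 *: D v by rewrite scale_lfunE.
have tsym v w : b (t v) w = b v (t w).
  by rewrite !tE dotZl [b v _]dotC dotZl [b (D w) v]dotC Dsym.
have t_ge0 v : 0 <= b (t v) v.
  by rewrite tE dotZl mulr_ge0// invr_ge0 ltW.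
have iter_t k : (1 - x) ^+ k * b (iter k t e) e = b (iter k D e) e.
  suff -> : iter k D e = (1 - x) ^+ k *: iter k t e by rewrite dotZl.
  elim: k => [|k /= ->]; first by rewrite scale1r.
  by rewrite tE scalerA exprSr mulfK ?gt_eqF// linearZ.
have := convex_seq_bound x_ge0 nx_le1 (moments_convex e tsym t_ge0).
rewrite -(ler_pM2l (exprn_gt0 n c_gt0)); congr (_ <= _).
  by rewrite -!iter_t exprSr; ring.
by rewrite /= tE dotZl /=; congr (_ * (_ + _ * _)); field; rewrite gt_eqF.
Qed.

(** * The inner product defined by the inverse of the smoother *)

Lemma symmetric_posdefK {R : realType} {Vt : vectType R} (S : 'Hom(dual Vt, Vt)) :
  symmetric_posdef S -> cancel S (S^-1)%VF /\ cancel (S^-1)%VF S.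
Proof.
move=> [_ S_pos].
have inj : lker S == 0%VS.
  apply/eqP/vspaceP => g; rewrite memv_ker memv0.
  apply/eqP/eqP => [Sg0|->]; last by rewrite linear0.
  by apply: contraTeq isT => /S_pos; rewrite Sg0 linear0 ltxx.
split; first exact: lker0_lfunK.
have full := limg_full_of_lker0 inj dim_dual.
by move=> v; rewrite limg_lfunVK// full memvf.
Qed.

Lemma inv_form_dot {R : realType} {Vt : vectType R} (S : 'Hom(dual Vt, Vt)) :
    symmetric_posdef S ->
  exists b : {dot Vt for idfun}, forall v w, b v w = (S^-1)%VF v w.
Proof.
move=> S_spd; have [SK SVK] := symmetric_posdefK S_spd.
pose beta v w : R := (S^-1)%VF v w.
have betaC v w : beta v w = beta w v.
  by rewrite /beta -{1}[w]SVK -{2}[v]SVK S_spd.1.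
have beta_pos v : v != 0 -> 0 < beta v v.
  move=> v0; rewrite /beta -{2}[v]SVK S_spd.2//.
  by apply: contra_neq v0 => g0; rewrite -[v]SVK g0 linear0.
have lin_r v : linear_for *%R (beta v) by move=> t x y; rewrite /beta linearP.
have lin_l w : linear_for *%R (beta^~ w).
  by move=> t x y; rewrite betaC lin_r ![beta w _]betaC.
pose bil := @bilinear_isBilinear.Build R Vt Vt R *%R *%R beta (lin_l, lin_r).
have herm x y : beta x y = (-1) ^+ false * idfun (beta y x).
  by rewrite expr0 mul1r /= betaC.
pose b : {dot Vt for idfun} := HB.pack beta bil
  (isHermitianSesquilinear.Build _ _ _ _ beta herm)
  (isDotProduct.Build _ _ beta beta_pos).
by exists b.
Qed.

(** * The damping factor *)

Lemma eps_m_ge0 {R : realType} (delta : R) m : 1 < delta -> 0 <= eps_m delta m.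
Proof.
move=> delta_gt1; rewrite /eps_m; case: ifP => _.
  by rewrite exprn_ge0// divr_ge0//; lra.
by rewrite mulr_ge0 ?powR_ge0// divr_ge0 ?powR_ge0// mulr_ge0 ?powR_ge0 ?exprn_ge0.
Qed.

(** In the second case the square is delta times the maximum over [0, 1] of
    l (1 - l)^(2m), which is attained at x = 1/(2m + 1). *)
Lemma eps_m_sqr {R : realType} (delta : R) m (x := m.*2.+1%:R^-1) :
    1 < delta ->
  eps_m delta m ^+ 2 = if m%:R <= (delta - 1) / 2
    then (1 - delta^-1) ^+ m.*2 else delta * x * (1 - x) ^+ m.*2.
Proof.
move=> delta_gt1; rewrite /eps_m; case: ifP => _.
  rewrite -exprM muln2; congr (_ ^+ _); field; lra.
have s_gt0 : 0 < m%:R + 1 / 2 :> R by rewrite ltr_wpDl// ?divr_gt0.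
have xE : x = (2 * (m%:R + 1 / 2))^-1.
  by rewrite /x -natr1 -muln2 natrM; congr (_^-1); field.
have x1E : 1 - x = m%:R / (m%:R + 1 / 2) by rewrite xE; field; lra.
rewrite x1E powRD; last by rewrite gt_eqF// implybT.
rewrite powR_mulrn ?ltW// !div1r !powR12_sqrt; [|lra..].
rewrite !(exprMn, exprVn) !sqr_sqrtr; [|lra..].
rewrite -!exprM muln2 xE; field.
by apply/andP; split; [apply: expf_neq0|]; rewrite gt_eqF//; lra.
Qed.

Lemma eps_m_le1 {R : realType} (delta : R) m : 1 < delta -> eps_m delta m <= 1.
Proof.
move=> delta_gt1; rewrite -(expr_le1 (n := 2))// ?eps_m_ge0// eps_m_sqr//.
have d_gt0 : 0 < delta by lra.
have dV : 0 < delta^-1 < 1 by rewrite invr_gt0 d_gt0 invf_lt1.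
case: ifPn => [_|]; first by apply: exprn_ile1; lra.
rewrite -ltNge => m_gt.
have x_gt0 : 0 < (m.*2.+1%:R : R)^-1 by rewrite invr_gt0.
have x_le1 : (m.*2.+1%:R : R)^-1 <= 1 by rewrite invf_le1// ler1n.
have c_ge0 : 0 <= 1 - (m.*2.+1%:R : R)^-1 by rewrite subr_ge0.
have c_le1 : 1 - (m.*2.+1%:R : R)^-1 <= 1 by rewrite gerBl ltW.
apply: mulr_ile1; [by rewrite mulr_ge0 ?ltW|by rewrite exprn_ge0| |
  by rewrite exprn_ile1].
by rewrite ler_pdivrMr// mul1r -natr1 -muln2 natrM; lra.
Qed.

(** [smoothing_bound] with n = 2m.  The tangent at x = 1/delta has slope at most
    (1 - x)^n and b(Te, e) >= x b(e, e), hence the factor (1 - x)^n.  The tangent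
    at x = 1/(n+1) is horizontal, so that b(e, e) <= delta b(Te, e) turns its
    constant value into the factor delta x (1 - x)^n. *)
Lemma smoothing_reduction {R : realType} {Vt : vectType R}
    (b : {dot Vt for idfun}) (D : 'End(Vt)) (e : Vt) (delta : R) (m : nat) :
    (forall v w, b (D v) w = b v (D w)) -> (forall v, 0 <= b (D v) v) ->
    1 < delta -> (0 < m)%N -> b e e <= delta * (b e e - b (D e) e) ->
  b (iter m.*2 D e) e - b (iter m.*2.+1 D e) e <=
    eps_m delta m ^+ 2 * (b e e - b (D e) e).
Proof.
move=> Dsym D_ge0 delta_gt1 m_gt0 e_le.
have d_gt0 : 0 < delta by lra.
have dV_gt0 : 0 < delta^-1 by rewrite invr_gt0.
have dV_lt1 : delta^-1 < 1 by rewrite invf_lt1.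
have be_ge0 : 0 <= b e e := dot_ge0 b e.
have bound x := @smoothing_bound R Vt b D e x m.*2 Dsym D_ge0.
have N_gt1 : 1 < m.*2.+1%:R :> R by rewrite ltr1n ltnS double_gt0.
have NE : m.*2.+1%:R = 2 * m%:R + 1 :> R by rewrite -natr1 -muln2 natrM mulrC.
rewrite eps_m_sqr//; move: (m.*2.+1%:R) => N in bound N_gt1 NE *.
move: (b e e - b (D e) e) => al in bound e_le *.
have al_ge : delta^-1 * b e e <= al by rewrite ler_pdivrMl.
case: ifPn => [m_le|_].
  apply: le_trans (bound delta^-1 _ _ _) _ => //; first exact: ltW.
    by rewrite ler_pdivrMr// mul1r NE; lra.
  rewrite ler_wpM2l ?exprn_ge0 ?subr_ge0 ?(ltW dV_lt1)//.
  rewrite -lerBrDl.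
  rewrite mulrA ler_pdivrMr ?subr_gt0// [leRHS]mulrC ler_wpM2r ?subr_ge0//.
  by rewrite lerD2l lerN2 ler_peMl ?ltW.
have x_gt0 : 0 < N^-1 by rewrite invr_gt0; lra.
have x_lt1 : N^-1 < 1 by rewrite invf_lt1; lra.
have Nx : N * N^-1 = 1 by rewrite divff// gt_eqF//; lra.
apply: le_trans (bound _ (ltW x_gt0) x_lt1 _) _; first by rewrite Nx.
rewrite Nx subrr mul0r addr0 mulrA.
rewrite [leRHS](_ : _ = (1 - N^-1) ^+ m.*2 * N^-1 * (delta * al)); last by ring.
by rewrite ler_wpM2l// mulr_ge0 ?exprn_ge0 ?subr_ge0 ?ltW.
Qed.

(** * The smoothing iteration *)

(** The exact solution is a fixed point of the affine map [smooth_step], whose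
    linear part is 1 - SA. *)
Lemma smoothing_error {R : realType} {Vt : vectType R} (a : {dot Vt for idfun})
    (S : 'Hom(dual Vt, Vt)) (ft : dual Vt) uth w m :
    (forall v, a uth v = ft v) ->
  uth - smoothing a S ft m w =
    iter m (\1%VF - (S \o energy_op a)%VF : 'End(Vt)) (uth - w).
Proof.
move=> uth_sol; have -> : ft = energy_op a uth.
  by apply/lfunP => v; rewrite energy_opE uth_sol.
rewrite /smoothing; elim: m => //= m <-; set z := iter m _ w.
rewrite add_lfunE opp_lfunE id_lfunE comp_lfunE /= /smooth_step.
by rewrite -[in LHS]linearB opprD addrA.
Qed.

(** For the inner product b of S^-1, a(v, w) = b(v, w) - b(Dv, w): the energy of
    D^m e is a difference of consecutive moments of D, and the hypothesis on
    [inv_norm] says that b(e, e) <= delta a(e, e). *)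
Lemma smoothing_energy_le {R : realType} {Vt : vectType R} (a : {dot Vt for idfun})
    (S : 'Hom(dual Vt, Vt)) (ft : dual Vt) uth w (delta : R) m :
    symmetric_posdef S -> 1 < delta -> (0 < m)%N ->
    lambda_max (S \o energy_op a)%VF <= 1 -> (forall v, a uth v = ft v) ->
    inv_norm S (uth - w) <= Num.sqrt delta * energy_norm a (uth - w) ->
  energy_norm a (uth - smoothing a S ft m w) <=
    eps_m delta m * energy_norm a (uth - w).
Proof.
move=> S_spd delta_gt1 m_gt0 SA_le1 uth_sol.
rewrite (smoothing_error S w m uth_sol); set T := (S \o _)%VF; set e := uth - w.
have [b bE] := inv_form_dot S_spd; have [SK _] := symmetric_posdefK S_spd.
have bT v x : b (T v) x = a v x by rewrite bE comp_lfunE SK energy_opE.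
have Tsym v x : b (T v) x = b v (T x) by rewrite bT dotC -bT dotC.
pose D : 'End(Vt) := \1%VF - T.
have DE v : D v = v - T v by rewrite add_lfunE opp_lfunE id_lfunE.
have Dsym v x : b (D v) x = b v (D x) by rewrite !DE dotBl dotBr Tsym.
have D_ge0 v : 0 <= b (D v) v.
  rewrite DE dotBl subr_ge0 -[leRHS]mul1r.
  apply: quadratic_form_le_eigenvalues => // l.
  by move=> /(eigenvalue_le_lambda_max b) /le_trans; apply.
have aE v : b v v - b (D v) v = a v v by rewrite DE dotBl bT opprB addrC subrK.
rewrite /inv_norm -bE -/D => e_le.
have {}e_le : b e e <= delta * (b e e - b (D e) e).
  have d_ge0 : 0 <= delta by lra.
  by move: e_le; rewrite /energy_norm -sqrtrM// ler_sqrt ?aE// mulr_ge0 ?dot_ge0.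
have := smoothing_reduction Dsym D_ge0 delta_gt1 m_gt0 e_le.
have -> : b (iter m.*2 D e) e - b (iter m.*2.+1 D e) e =
    a (iter m D e) (iter m D e).
  by rewrite -aE -addnn -addnS !iterD !(iter_sym Dsym).
rewrite aE => h; rewrite /energy_norm -[eps_m _ _]ger0_norm ?eps_m_ge0//.
by rewrite -sqrtr_sqr -sqrtrM ?sqr_ge0// ler_wsqrtr.
Qed.

Theorem theorem2p2 (R : realType) (Vt : vectType R) (V : {vspace Vt})
    (a : {dot Vt for idfun})
    (X : lmodType R) (iota : {linear Vt -> X}) (iota_inj : injective iota)
    (u : X) (normX : X -> R)
    (normX_seminorm : seminorm_on (add_span iota u) normX)
    (normX_energy : forall v : Vt, normX (iota v) = energy_norm a v)
    (f : dual (subvs_of V)) (ft : dual Vt)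
    (ft_restr : forall v : subvs_of V, ft (vsval v) = f v)
    (uh : subvs_of V)
    (uh_sol : forall v : subvs_of V, a (vsval uh) (vsval v) = f v)
    (uth : Vt) (uth_sol : forall v : Vt, a uth v = ft v)
    (S : 'Hom(dual Vt, Vt)) (S_spd : symmetric_posdef S)
    (delta : R) (delta_gt1 : 1 < delta)
    (SA_le1 : lambda_max (S \o energy_op a)%VF <= 1)
    (inv_norm_le : inv_norm S (uth - vsval uh) <=
       Num.sqrt delta * energy_norm a (uth - vsval uh))
    (m : nat) (m_ge1 : (1 <= m)%N) :
  normX (u - iota (smoothing a S ft m (vsval uh))) <=
    2 * normX (u - iota uth) + eps_m delta m * normX (u - iota (vsval uh)).
Proof.
have [p_ge0 pZ p_tri] := normX_seminorm.
have sub_span v : add_span iota u (u - iota v).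
  by exists (- v), 1; rewrite linearN scale1r addrC.
have iota_span v : add_span iota u (iota v).
  by exists v, 0; rewrite scale0r addr0.
set e := uth - vsval uh in inv_norm_le *.
have e_le : energy_norm a e <= normX (u - iota uth) + normX (u - iota (vsval uh)).
  rewrite -normX_energy /e.
  have -> : iota (uth - vsval uh) = - 1 *: (u - iota uth) + (u - iota (vsval uh)).
    by rewrite linearB scaleN1r opprB addrA subrK.
  apply: le_trans (p_tri _ _ _ _) _ => //.
    by exists uth, (- 1); rewrite scalerBr !scaleN1r opprK addrC.
  by rewrite pZ// normrN1 mul1r.
set z := smoothing _ _ _ _ _.
have split_z : normX (u - iota z) <= normX (u - iota uth) + energy_norm a (uth - z).
  have -> : u - iota z = (u - iota uth) + iota (uth - z).
    by rewrite linearB addrA subrK.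
  by rewrite -normX_energy p_tri.
have eps_ge0 := eps_m_ge0 m delta_gt1; have eps_le1 := eps_m_le1 m delta_gt1.
have := smoothing_energy_le S_spd delta_gt1 m_ge1 SA_le1 uth_sol inv_norm_le.
rewrite -/z -/e.
have := ler_wpM2l eps_ge0 e_le.
have := ler_wpM2r (p_ge0 _ (sub_span uth)) eps_le1.
lra.
Qed.
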